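(* Let $d \geq 2$ and let $C \subset \mathbb{R}^d$ be a smooth $d$-dimensional combinatorial cube. Then $C$ has two facets which are parallel to each other.
   Context: A lattice polytope is the convex hull of finitely many points of $\mathbb{Z}^d$. A $d$-dimensional polytope is simple if each vertex lies in exactly $d$ edges. The primitive edge directions at a vertex are the smallest lattice vectors pointing along its incident edges. A $d$-dimensional lattice polytope in $\mathbb{R}^d$ is smooth if it is simple and at every vertex the primitive edge directions form a basis of $\mathbb{Z}^d$. A $d$-dimensional combinatorial cube is a polytope whose face poset is isomorphic to that of $[0,1]^d$. Two faces $F,G$ are parallel if $\mathrm{lin}(F)=\mathrm{lin}(G)$, where $\mathrm{lin}(F)$ is the linear subspace parallel to the affine hull of $F$. *)

(* Defs.v *)
From HB Require Import structures.
From mathcomp Require Import all_boot all_order all_algebra.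
From mathcomp Require Import boolp classical_sets reals.
Set Implicit Arguments. Unset Strict Implicit. Unset Printing Implicit Defensive.
Import Order.TTheory GRing.Theory Num.Theory.
Local Open Scope classical_set_scope.
Local Open Scope ring_scope.

Section Polytopes.
Variables (R : realType) (d : nat).
Notation pt := 'rV[R]_d.

Definition dot (a x : pt) : R := \sum_(i < d) a 0 i * x 0 i.

Definition lat (z : 'rV[int]_d) : pt := map_mx (fun k : int => k%:~R) z.

Definition conv (S : seq pt) : set pt :=
  [set x | exists lam : 'I_(size S) -> R,
     (forall i, 0 <= lam i) /\ \sum_i lam i = 1 /\
     x = \sum_i lam i *: S`_i].

Definition lattice_polytope (P : set pt) : Prop :=
  exists V : seq 'rV[int]_d, P = conv (map lat V).

(* faces: intersections with supporting hyperplanes (includes P and the empty set) *)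
Definition face (P F : set pt) : Prop :=
  exists (a : pt) (b : R), (forall x, P x -> dot a x <= b) /\
    F = P `&` [set x | dot a x = b].

(* U = lin(F): the linear subspace spanned by differences of points of F,
   i.e. the subspace parallel to the affine hull of F *)
Definition is_lin (F : set pt) (U : {vspace pt}) : Prop :=
  (forall x y, F x -> F y -> x - y \in U) /\
  (forall W : {vspace pt}, (forall x y, F x -> F y -> x - y \in W) -> (U <= W)%VS).

Definition has_dim (F : set pt) (k : nat) : Prop :=
  F !=set0 /\ exists U, is_lin F U /\ \dim U = k.

Definition vertex (P F : set pt) := face P F /\ has_dim F 0.
Definition edge (P F : set pt) := face P F /\ has_dim F 1.
Definition facet (P F : set pt) := face P F /\ has_dim F d.-1.

Definition parallel (F G : set pt) : Prop :=
  exists U, is_lin F U /\ is_lin G U.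

Definition edges_at (P : set pt) (v : pt) (e : 'I_d -> set pt) : Prop :=
  injective e /\ (forall E, (edge P E /\ E v) <-> exists i, E = e i).

Definition simple (P : set pt) : Prop :=
  has_dim P d /\
  forall v, vertex P [set v] -> exists e, edges_at P v e.

Definition primitive_dir (E : set pt) (v : pt) (u : 'rV[int]_d) : Prop :=
  u != 0 /\ (exists t : R, 0 < t /\ E (v + t *: lat u)) /\
  (forall (u' : 'rV[int]_d) (s : R), 0 < s -> lat u' = s *: lat u -> 1 <= s).

Definition Zbasis (u : 'I_d -> 'rV[int]_d) : Prop :=
  forall z : 'rV[int]_d, exists! c : 'I_d -> int, z = \sum_i c i *: u i.

Definition smooth (P : set pt) : Prop :=
  simple P /\
  forall v e u, vertex P [set v] -> edges_at P v e ->
    (forall i, primitive_dir (e i) v (u i)) -> Zbasis u.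

Definition face_poset_iso (P Q : set pt) : Prop :=
  exists f : set pt -> set pt,
    (forall F, face P F -> face Q (f F)) /\
    (forall G, face Q G -> exists F, face P F /\ f F = G) /\
    (forall F G, face P F -> face P G -> (F `<=` G <-> f F `<=` f G)).

Definition unit_cube : set pt :=
  conv [seq \row_i (((f : {ffun 'I_d -> bool}) i)%:R : R) | f <- enum {ffun 'I_d -> bool}].

Definition comb_cube (P : set pt) : Prop := face_poset_iso P unit_cube.

End Polytopes.

(* Main.v *)
Require Import Defs.
From mathcomp Require Import all_boot all_order all_algebra.
From mathcomp Require Import boolp classical_sets reals.
From mathcomp Require Import ring lra.
Set Implicit Arguments. Unset Strict Implicit. Unset Printing Implicit Defensive.
Import Order.TTheory GRing.Theory Num.Theory.
Local Open Scope classical_set_scope.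
Local Open Scope ring_scope.

(** Take a nonempty list of integer outer facet normals with sum zero, of least
degree, the degree being the sum of the maxima over [C] of the listed functionals
(this is Batyrev's argument on primitive relations). The facets listed have no
common point, since the functionals sum to zero; in a combinatorial cube this
forces two of them, with normals [n] and [m], to be disjoint. The functional
[n + m] attains its maximum over [C] at a vertex, where smoothness writes it as
a nonnegative integer combination of facet normals; as the two facets are
disjoint, replacing [n], [m] by this combination lowers the degree. By minimality
the new list is empty, so [n + m = 0] and the two facets are parallel. *)

(** * Dot products and lattice vectors *)

Section Dot.
Variables (R : realType) (d : nat).
Implicit Types (a b x y : 'rV[R]_d) (r : R) (z w : 'rV[int]_d).

Lemma dotE a x : dot a x = (x *m a^T) 0 0.
Proof. by rewrite mxE; apply: eq_bigr => i _; rewrite mxE mulrC. Qed.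

Lemma dotC a x : dot a x = dot x a.
Proof. by apply: eq_bigr => i _; rewrite mulrC. Qed.

Lemma dotDr a x y : dot a (x + y) = dot a x + dot a y.
Proof. by rewrite !dotE mulmxDl mxE. Qed.

Lemma dotZr a r x : dot a (r *: x) = r * dot a x.
Proof. by rewrite !dotE -scalemxAl mxE. Qed.

Lemma dot0r a : dot a 0 = 0.
Proof. by rewrite dotE mul0mx mxE. Qed.

Lemma dotNr a x : dot a (- x) = - dot a x.
Proof. by rewrite -scaleN1r dotZr mulN1r. Qed.

Lemma dotBr a x y : dot a (x - y) = dot a x - dot a y.
Proof. by rewrite dotDr dotNr. Qed.

Lemma dot_sumr a (I : Type) (s : seq I) (F : I -> 'rV[R]_d) :
  dot a (\sum_(i <- s) F i) = \sum_(i <- s) dot a (F i).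
Proof. by apply: (big_morph (dot a)); [exact: dotDr | exact: dot0r]. Qed.

Lemma dotDl a b x : dot (a + b) x = dot a x + dot b x.
Proof. by rewrite !(dotC _ x) dotDr. Qed.

Lemma dotZl r a x : dot (r *: a) x = r * dot a x.
Proof. by rewrite !(dotC _ x) dotZr. Qed.

Lemma dotNl a x : dot (- a) x = - dot a x.
Proof. by rewrite !(dotC _ x) dotNr. Qed.

Lemma dot0l x : dot 0 x = 0.
Proof. by rewrite dotC dot0r. Qed.

Lemma dot_suml (I : Type) (s : seq I) (F : I -> 'rV[R]_d) x :
  dot (\sum_(i <- s) F i) x = \sum_(i <- s) dot (F i) x.
Proof. by rewrite dotC dot_sumr; apply: eq_bigr => i _; rewrite dotC. Qed.

Lemma dotvv_gt0 x : x != 0 -> 0 < dot x x.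
Proof.
move=> x0; rewrite lt0r sumr_ge0 ?andbT => [|i _]; last exact: sqr_ge0.
apply: contra x0 => /eqP s0; apply/eqP/rowP => i; rewrite mxE.
have /(_ i isT)/eqP := psumr_eq0P (fun i _ => sqr_ge0 (x 0 i)) s0.
by rewrite expf_eq0 => /andP[_ /eqP].
Qed.

Lemma latD z w : lat R (z + w) = lat R z + lat R w.
Proof. by apply/rowP => i; rewrite !mxE intrD. Qed.

Lemma lat0 : lat R (0 : 'rV_d) = 0.
Proof. by apply/rowP => i; rewrite !mxE. Qed.

Lemma latN z : lat R (- z) = - lat R z.
Proof. by apply/rowP => i; rewrite !mxE rmorphN. Qed.

Lemma latB z w : lat R (z - w) = lat R z - lat R w.
Proof. by rewrite latD latN. Qed.

Lemma lat_sum (I : Type) (s : seq I) (F : I -> 'rV[int]_d) :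
  lat R (\sum_(i <- s) F i) = \sum_(i <- s) lat R (F i).
Proof. by apply: (big_morph (@lat R d)); [exact: latD | exact: lat0]. Qed.

Lemma lat_inj : injective (@lat R d).
Proof.
move=> z w zw; apply/rowP => i; have /rowP/(_ i) := zw.
by rewrite !mxE => /eqP; rewrite eqr_int => /eqP.
Qed.

Lemma lat_eq0 z : (lat R z == 0) = (z == 0).
Proof. by rewrite -lat0 (inj_eq lat_inj). Qed.

Lemma dot_lat z w : dot (lat R z) (lat R w) = ((z *m w^T) 0 0)%:~R.
Proof. by rewrite mxE rmorph_sum; apply: eq_bigr => i _; rewrite !mxE rmorphM. Qed.

End Dot.

(** * Vertices and edges of a polytope *)

Section Convexity.
Variables (R : realType) (d : nat).
Implicit Types (a h v x : 'rV[R]_d) (S : seq 'rV[R]_d) (P E : set 'rV[R]_d).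

Lemma conv_mem S x : x \in S -> conv S x.
Proof.
move=> xS; have ix : (index x S < size S)%N by rewrite index_mem.
exists (fun i => (i == Ordinal ix)%:R); split=> [i|]; first by case: eqP.
split.
  by rewrite (bigD1 (Ordinal ix)) //= eqxx big1 ?addr0 // => i /negPf->.
rewrite (bigD1 (Ordinal ix)) //= eqxx scale1r nth_index // big1 ?addr0 //.
by move=> i /negPf->; rewrite scale0r.
Qed.

Lemma conv_neq_nil S : conv S !=set0 -> S != [::].
Proof.
move=> [x Sx]; apply/eqP => S0; move: Sx; rewrite S0 => -[lam [_ [/esym/eqP]]].
by rewrite big_ord0 oner_eq0.
Qed.

Lemma conv_le S a b x :
  {in S, forall s, dot a s <= b} -> conv S x -> dot a x <= b.
Proof.
move=> Sb [lam [lam0 [lam1 ->]]]; rewrite dot_sumr -[b]mul1r -lam1 mulr_suml.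
by apply: ler_sum => i _; rewrite dotZr ler_wpM2l // Sb // mem_nth.
Qed.

(** A convex combination can reach the bound [b] only if every point of positive weight does, so the
    generators on a face control the whole face. *)
Lemma conv_face_sub S h b v (W : {vspace 'rV[R]_d}) x :
  {in S, forall s, dot h s <= b} ->
  {in S, forall s, dot h s = b -> s - v \in W} ->
  conv S x -> dot h x = b -> x - v \in W.
Proof.
move=> Sb SW [lam [lam0 [lam1 ->]]]; rewrite dot_sumr => hx.
have sum0 : \sum_i lam i * (b - dot h S`_i) = 0.
  under eq_bigr do rewrite mulrBr -dotZr.
  by rewrite sumrB hx -mulr_suml lam1 mul1r subrr.
have term0 := psumr_eq0P _ sum0.
rewrite -[v]scale1r -lam1 scaler_suml -sumrB; apply: memv_suml => i _.
rewrite -scalerBr; have [->|lamN0] := eqVneq (lam i) 0.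
  by rewrite scale0r mem0v.
apply/memvZ/SW; first exact: mem_nth.
have {}term0 : lam i * (b - dot h S`_i) = 0.
  by apply: term0 => // j _; rewrite mulr_ge0 // subr_ge0 Sb // mem_nth.
by move/eqP: term0; rewrite mulf_eq0 (negPf lamN0) subr_eq0 => /eqP.
Qed.

Lemma seq_argmax (T : eqType) (s : seq T) (f : T -> R) :
  s != [::] -> exists2 p, p \in s & {in s, forall q, f q <= f p}.
Proof.
elim: s => // p [|q s] IH _.
  by exists p; rewrite ?mem_head // => x; rewrite inE => /eqP->.
have [//|r rs rmax] := IH _; have [fpr|frp] := leP (f p) (f r).
  exists r; first by rewrite inE rs orbT.
  by move=> x; rewrite inE => /predU1P[->|/rmax].
exists p; rewrite ?mem_head // => x; rewrite inE => /predU1P[->//|/rmax fxr].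
exact: le_trans fxr (ltW frp).
Qed.

Lemma seq_uniform_bound (T : eqType) (s : seq T) (Q : T -> R -> Prop) :
  {in s, forall q, exists K, forall K', K <= K' -> Q q K'} ->
  exists K, {in s, forall q, Q q K}.
Proof.
move=> sQ; suff [K KQ] : exists K, {in s, forall q K', K <= K' -> Q q K'}.
  by exists K => q qs; apply: KQ.
elim: s sQ => [|p s IH] sQ; first by exists 0.
have [|K1 K1Q] := IH; first by move=> q qs; apply: sQ; rewrite inE qs orbT.
have [|K2 K2Q] := sQ p; first by rewrite mem_head.
exists (Num.max K1 K2) => q; rewrite inE => /predU1P[->|qs] K'.
  by rewrite ge_max => /andP[_ /K2Q].
by rewrite ge_max => /andP[/(K1Q _ qs)].
Qed.

(* Among the maximizers of [a] take one of largest Euclidean norm, [p]: then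
   [K *: a + p] singles it out once [K] is large. *)
Lemma exposed_maximizer S a : S != [::] ->
  exists p h, [/\ p \in S, {in S, forall q, dot a q <= dot a p} &
    {in S, forall q, q != p -> dot h q < dot h p}].
Proof.
move=> /(seq_argmax (dot a))[p0 p0S p0max].
have : [seq q <- S | dot a q == dot a p0] != [::].
  by rewrite -has_filter; apply/hasP; exists p0.
move=> /(seq_argmax (fun q => dot q q))[p].
rewrite mem_filter => /andP[/eqP pp0 pS] pmax.
have [|K KP] := @seq_uniform_bound _ S
    (fun q K => q != p -> K * dot a q + dot p q < K * dot a p + dot p p).
  move=> q qS; have [aqp|aqp] := eqVneq (dot a q) (dot a p).
    (* On a tie for [a], expanding [|q - p|^2 > 0] with [|q| <= |p|] gives [dot p q < dot p p]. *)
    exists 0 => K' _ qp; rewrite aqp ltrD2l.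
    have := pmax q; rewrite mem_filter aqp pp0 eqxx qS => /(_ isT).
    have : 0 < dot (q - p) (q - p) by apply: dotvv_gt0; rewrite subr_eq0.
    rewrite dotBr !(dotC (q - p)) !dotBr (dotC q p); lra.
  have apos : 0 < dot a p - dot a q by rewrite subr_gt0 lt_neqAle aqp pp0 p0max.
  exists ((`|dot p q - dot p p| + 1) / (dot a p - dot a q)) => K'.
  rewrite ler_pdivrMr // => K'P _.
  have := ler_norm (dot p q - dot p p); nra.
exists p, (K *: a + p); split=> // [q qS|q qS qp]; first by rewrite pp0 p0max.
by rewrite !dotDl !dotZl; apply: KP.
Qed.

Lemma is_lin_set1 v : is_lin [set v] 0%VS.
Proof.
by split=> [x y -> ->|W _]; rewrite ?subrr ?mem0v ?sub0v.
Qed.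

Lemma is_lin_uniq (F : set 'rV[R]_d) U W : is_lin F U -> is_lin F W -> U = W.
Proof.
by move=> [U1 U2] [W1 W2]; apply/eqP; rewrite eqEsubv U2 // W2.
Qed.

Lemma face_sub P F : face P F -> F `<=` P.
Proof. by move=> [a [b [_ ->]]] x []. Qed.

Lemma conv_max_vertex S a : S != [::] ->
  exists v, [/\ v \in S, vertex (conv S) [set v] &
    forall x, conv S x -> dot a x <= dot a v].
Proof.
move=> /(@exposed_maximizer _ a)[v [h [vS amax hmax]]]; exists v.
have hle : {in S, forall q, dot h q <= dot h v}.
  by move=> q qS; have [->//|/(hmax q qS)/ltW] := eqVneq q v.
split=> // [|x]; last exact: conv_le.
split; last first.
  split; first by exists v.
  by exists 0%VS; rewrite dimv0; split=> //; exact: is_lin_set1.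
exists h, (dot h v); split=> [x|]; first exact: conv_le.
rewrite eqEsubset; split=> [x ->|x [xS hx]]; first by split=> //; exact: conv_mem.
have := @conv_face_sub S h _ v 0%VS x hle _ xS hx.
rewrite memv0 subr_eq0 => eqxv; apply/eqP/eqxv => q qS hq.
by have [->|/(hmax q qS)] := eqVneq q v; rewrite ?subrr ?mem0v // hq ltxx.
Qed.

Lemma vertex_functional P v : vertex P [set v] ->
  P v /\ exists a, forall x, P x -> x != v -> dot a x < dot a v.
Proof.
move=> [[a [b [ab vE]]] _].
have [Pv av] : (P `&` [set x | dot a x = b]) v by rewrite -vE.
split=> //; exists a => x Px xv; rewrite av lt_neqAle ab // andbT.
apply: contra xv => /eqP ax; apply/eqP.
by have : (P `&` [set x | dot a x = b]) x by []; rewrite -vE.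
Qed.

(* The optimality criterion of the simplex method. If some point of [S] were
   lower than [v], rescale the differences [s - v] to a hyperplane cutting the
   vertex; an exposed lowest one among them spans an edge along which [g]
   decreases. *)
Lemma edgewise_min S g v : vertex (conv S) [set v] ->
  (forall E x, edge (conv S) E -> E v -> E x -> dot g v <= dot g x) ->
  forall x, conv S x -> dot g v <= dot g x.
Proof.
move=> vtx gE x Sx; have [Sv [a av]] := vertex_functional vtx.
rewrite -lerN2 -!dotNl; apply: conv_le Sx => s sS; rewrite !dotNl lerN2 leNgt.
apply/negP => gs; pose N y := (dot a v - dot a y)^-1 *: (y - v).
have sv : s != v by apply: contraTneq gs => ->; rewrite ltxx.
pose T := [seq N y | y <- S & y != v].
have Ts : N s \in T by rewrite map_f // mem_filter sv.
have apos y : y \in S -> y != v -> 0 < dot a v - dot a y.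
  by move=> yS yv; rewrite subr_gt0 av //; exact: conv_mem.
have NK y : y \in S -> y != v -> y - v = (dot a v - dot a y) *: N y.
  by move=> yS yv; rewrite scalerA divff ?scale1r // gt_eqF ?apos.
have [|p [h [pT gp hp]]] := @exposed_maximizer T (- g).
  by case: (T) Ts.
have {}gp : dot g p < 0.
  have := gp _ Ts; rewrite !dotNl lerN2 => /le_lt_trans; apply.
  by rewrite dotZr dotBr pmulr_rlt0 ?subr_lt0 // invr_gt0 apos.
have p0 : p != 0 by apply: contraTneq gp => ->; rewrite dot0r ltxx.
have /mapP[s0] := pT; rewrite mem_filter => /andP[s0v s0S] ps0.
(* [dot a] is -1 on every [N y], so [dot c (N y) = dot h (N y) - dot h p]: at most 0, and 0 only
   when [N y = p]. *)
pose c := h + dot h p *: a.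
have cE y : y \in S -> y != v ->
    dot c y - dot c v = (dot a v - dot a y) * (dot h (N y) - dot h p).
  move=> yS yv; rewrite mulrBr -dotZr -NK // /c !dotDl !dotZl dotBr; ring.
have cle : {in S, forall y, dot c y <= dot c v}.
  move=> y yS; have [->//|yv] := eqVneq y v.
  rewrite -subr_le0 cE // pmulr_rle0 ?apos // subr_le0.
  have [->//|/hp Nyp] := eqVneq (N y) p.
  by apply/ltW/Nyp; rewrite map_f // mem_filter yv.
pose E := conv S `&` [set y | dot c y = dot c v].
have EW y : E y -> y - v \in <[p]>%VS.
  move=> [Sy cy]; apply: conv_face_sub cle _ Sy cy => q qS cq.
  have [->|qv] := eqVneq q v; first by rewrite subrr mem0v.
  have /eqP := cE _ qS qv; rewrite cq subrr eq_sym mulf_eq0 (gt_eqF (apos _ qS qv)) /=.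
  rewrite NK // subr_eq0; have [->|/hp Nqp] := eqVneq (N q) p.
    by rewrite memvZ ?memv_line.
  by rewrite (lt_eqF (Nqp _)) // map_f // mem_filter qv.
have Ev : E v by [].
have Es0 : E s0.
  split; first exact: conv_mem.
  by apply/eqP; rewrite -subr_eq0 cE // -ps0 subrr mulr0.
have edgeE : edge (conv S) E.
  split; first by exists c, (dot c v); split=> // y; exact: conv_le.
  split; first by exists v.
  exists <[p]>%VS; rewrite dim_vline p0; split=> //; split.
    move=> y z Ey Ez; have -> : y - z = (y - v) - (z - v) by rewrite opprB addrA subrK.
    by rewrite memvB // EW.
  move=> W EWsub; rewrite -memvE ps0 memvZ //; exact: EWsub.
have := gE _ _ edgeE Ev Es0.
by rewrite -subr_ge0 -dotBr NK // -ps0 dotZr pmulr_rge0 ?apos // leNgt gp.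
Qed.

End Convexity.

(** * Facet normals at a smooth vertex *)

Section LatticeCone.
Variables (R : realType) (d : nat).
Implicit Types (z v w u : 'rV[int]_d) (x y g : 'rV[R]_d) (V : seq 'rV[int]_d).
Implicit Types (S : seq 'rV[R]_d) (P E : set 'rV[R]_d) (p q : 'rV[int]_d * int).

(** If [x] were the only generator on [E], then [conv_face_sub] with the zero subspace would shrink
    [E] to a point, against dimension 1. *)
Lemma edge_generator S E x : edge (conv S) E -> E x ->
  exists s, [/\ s \in S, E s & s != x].
Proof.
move=> [[a [b [ab EE]]] [_ [U [EU dimU]]]] Ex; apply: contrapT => noS.
suff E0 : is_lin E 0%VS by move: dimU; rewrite (is_lin_uniq EU E0) dimv0.
suff Ex0 y : E y -> y - x \in 0%VS.
  split=> [y z Ey Ez|W _]; last exact: sub0v.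
  have -> : y - z = (y - x) - (z - x) by rewrite opprB addrA subrK.
  by rewrite memvB // Ex0.
rewrite EE => -[Sy ay]; apply: conv_face_sub Sy ay => s sS.
  exact/ab/conv_mem.
move=> as_; have [->|sx] := eqVneq s x; first by rewrite subrr mem0v.
by case: noS; exists s; rewrite EE; split=> //; split=> //; exact: conv_mem.
Qed.

(** The difference of two lattice points of [E] is a candidate direction. A candidate of least
    l1-norm [wt] is primitive, since a shorter positive lattice multiple would be a candidate of
    smaller norm. *)
Lemma edge_primitive_dir V E v :
  edge (conv (map (@lat R d) V)) E -> E (lat R v) ->
  exists u, primitive_dir E (lat R v) u.
Proof.
move=> edgeE Ev; have [s [/mapP[w _ ->] Ew wv]] := edge_generator edgeE Ev.
pose wt u := (\sum_i `|u ord0 i|)%N.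
have wtE u : (wt u)%:R = \sum_i `|lat R u 0 i|.
  rewrite natr_sum; apply: eq_bigr => i _.
  by rewrite mxE -intr_norm -abszE.
pose cand u := u != 0 /\ exists t : R, 0 < t /\ E (lat R v + t *: lat R u).
have ex_cand : exists n, `[< exists2 u, cand u & wt u = n >].
  exists (wt (w - v)); apply/asboolP; exists (w - v) => //.
  rewrite /cand -(lat_eq0 R) latB subr_eq0; split=> //.
  by exists 1; rewrite scale1r addrC subrK ltr01.
have [n /asboolP[u [u0 [t [t0 Et]]] <-] nmin] := ex_minnP ex_cand.
exists u; split=> //; split; first by exists t.
move=> u' s' s'0 u'E; rewrite leNgt; apply/negP => s'1.
have lu0 : lat R u != 0 by rewrite lat_eq0.
have cand_u' : cand u'.
  split; first by rewrite -(lat_eq0 R) u'E scaler_eq0 (gt_eqF s'0).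
  exists (t / s'); rewrite divr_gt0 //; split=> //.
  by rewrite u'E scalerA divfK // gt_eqF.
have /nmin : `[< exists2 u, cand u & wt u = wt u' >].
  by apply/asboolP; exists u'.
rewrite -(ler_nat R).
have wtu0 : 0 < (wt u)%:R :> R.
  rewrite wtE lt0r sumr_ge0 // andbT; apply: contra lu0 => /eqP s0.
  apply/eqP/rowP => i; rewrite [RHS]mxE.
  by apply/normr0_eq0/(psumr_eq0P _ s0).
have -> : (wt u')%:R = s' * (wt u)%:R :> R.
  rewrite !wtE mulr_sumr; apply: eq_bigr => i _.
  by rewrite u'E [in LHS]mxE normrM gtr0_norm.
by rewrite leNgt gtr_pMl // s'1.
Qed.

(** Dimension 1 puts [E] on the line through [x] along [u]; a functional maximal only at [x]
    decreases along [u], which rules out negative [r]. *)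
Lemma edge_ray P E x y u : vertex P [set x] -> edge P E -> E x -> E y ->
  primitive_dir E x u -> exists2 r, 0 <= r & y = x + r *: lat R u.
Proof.
move=> vtx [faceE [_ [U [[EU _] dimU]]]] Ex Ey [u0 [[t [t0 Et]] _]].
have lu0 : lat R u != 0 by rewrite lat_eq0.
have luU : lat R u \in U.
  have := EU _ _ Et Ex; rewrite addrAC subrr add0r => /(memvZ t^-1).
  by rewrite scalerA mulVf ?scale1r // gt_eqF.
have : y - x \in <[lat R u]>%VS.
  suff -> : <[lat R u]>%VS = U by exact: EU.
  by apply/eqP; rewrite eqEdim -memvE luU dim_vline lu0 dimU.
move=> /vlineP[r yx]; have {yx}yE : y = x + r *: lat R u by rewrite -yx addrC subrK.
exists r => //; have [_ [a amax]] := vertex_functional vtx.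
have au : dot a (lat R u) < 0.
  have := amax _ (face_sub faceE Et); rewrite -subr_eq0 addrAC subrr add0r.
  rewrite scaler_eq0 (gt_eqF t0) (negPf lu0) => /(_ isT).
  by rewrite dotDr dotZr gtrDl pmulr_rlt0.
have [->|yx] := eqVneq r 0; first by [].
have := amax _ (face_sub faceE Ey); rewrite yE -subr_eq0 addrAC subrr add0r.
rewrite scaler_eq0 (negPf yx) (negPf lu0) => /(_ isT).
by rewrite dotDr dotZr gtrDl nmulr_llt0 // => /ltW.
Qed.

(** Every edge at the vertex lies on a ray along some [u i], so by [edgewise_min] the signs of [g]
    on the [u i] decide global minimality. *)
Lemma smooth_vertex_basis V v (P := conv (map (@lat R d) V)) :
  smooth P -> vertex P [set lat R v] ->
  exists u : 'I_d -> 'rV[int]_d, [/\ Zbasis u,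
    forall i, exists2 t : R, 0 < t & P (lat R v + t *: lat R (u i)) &
    forall g, (forall i, 0 <= dot g (lat R (u i))) ->
      forall x, P x -> dot g (lat R v) <= dot g x].
Proof.
move=> [[_ simp] smoo] vtx; have [e ee] := simp _ vtx.
have [_ eP] := ee.
have edge_e i : edge P (e i) /\ e i (lat R v) by apply/eP; exists i.
have /choice[u uP] i : exists ui, primitive_dir (e i) (lat R v) ui.
  by have [ei vi] := edge_e i; exact: edge_primitive_dir ei vi.
exists u; split; first exact: smoo vtx ee uP.
  move=> i; have [_ [[t [t0 et]] _]] := uP i; exists t => //.
  by have [[fe _] _] := edge_e i; exact: face_sub fe _ et.
move=> g gu; apply: (edgewise_min vtx) => E x edgeE Ev Ex.
have [i Ei] : exists i, E = e i by apply/eP; split.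
rewrite Ei in Ex; have [ei vi] := edge_e i.
have [r r0 ->] := edge_ray vtx ei vi Ex (uP i).
by rewrite dotDr dotZr lerDl mulr_ge0.
Qed.

(** Expanding the unit vectors in [u] gives an integer left inverse of the matrix with rows [u i].
    It is also a right inverse, and its columns form the dual basis. *)
Lemma Zbasis_dual (u : 'I_d -> 'rV[int]_d) : Zbasis u ->
  exists n : 'I_d -> 'rV[int]_d, [/\
    forall i j, (n i *m (u j)^T) 0 0 = (i == j)%:R,
    forall z, z = \sum_i (z *m (u i)^T) 0 0 *: n i &
    forall x, x = \sum_i dot (lat R (n i)) x *: lat R (u i)].
Proof.
move=> Zu; pose U := \matrix_i u i.
have /choice[c cP] k :
    exists ck : 'I_d -> int, delta_mx 0 k = \sum_i ck i *: u i.
  by have [ck [ckE _]] := Zu (delta_mx 0 k); exists ck.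
pose C := \matrix_(k, i) c k i.
have CU : C *m U = 1%:M.
  apply/row_matrixP => k; rewrite row_mul row1 cP mulmx_sum_row.
  by apply: eq_bigr => i _; rewrite rowK !mxE.
have UC := mulmx1C CU.
exists (fun i => row i C^T); split=> [i j|z|x].
- have -> : (i == j)%:R = (U *m C) j i by rewrite UC mxE eq_sym.
  by rewrite !mxE; apply: eq_bigr => k _; rewrite !mxE mulrC.
- rewrite -{1}[z]mulmx1 -trmx1 -CU trmx_mul mulmxA mulmx_sum_row.
  apply: eq_bigr => i _; congr (_ *: _).
  by rewrite !mxE; apply: eq_bigr => k _; rewrite !mxE.
have CU' : map_mx (fun k : int => k%:~R : R) C *m
    map_mx (fun k : int => k%:~R) U = 1%:M.
  by rewrite -map_mxM CU map_mx1.
rewrite -{1}[x]mulmx1 -CU' mulmxA mulmx_sum_row.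
apply: eq_bigr => i _; rewrite -map_row rowK dotC; congr (_ *: _).
by rewrite mxE; apply: eq_bigr => k _; rewrite !mxE.
Qed.

Definition hyperplane (a : 'rV[R]_d) : {vspace 'rV[R]_d} :=
  lker (linfun (mulmxr a^T : 'rV[R]_d -> 'rV[R]_1)).

Lemma mem_hyperplane a x : (x \in hyperplane a) = (dot a x == 0).
Proof.
rewrite memv_ker lfunE /= dotE; apply/eqP/eqP => [->|ax]; first by rewrite mxE.
by apply/rowP => i; rewrite ord1 ax mxE.
Qed.

Lemma dim_hyperplane a : a != 0 -> \dim (hyperplane a) = d.-1.
Proof.
move=> a0; pose f := linfun (mulmxr a^T : 'rV[R]_d -> 'rV[R]_1).
have dimE m : \dim {: 'rV[R]_m} = m by rewrite dimvf dim_matrix; exact: mul1n.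
have /eqP := limg_ker_dim f fullv; rewrite capfv.
suff -> : \dim (f @: fullv) = 1%N.
  by rewrite dimE addn1 => /eqP/(congr1 predn).
apply/eqP; rewrite eqn_leq; apply/andP; split.
  by rewrite (leq_trans (dimvS (subvf _))) // dimE.
rewrite lt0n dimv_eq0 -subv0; apply/negP => /subvP/(_ (f a)).
rewrite memv_img ?memvf // => /(_ isT); rewrite memv0 -memv_ker mem_hyperplane.
by rewrite gt_eqF // dotvv_gt0.
Qed.

(** A pair [p] holds a normal and its height; integer heights make the degree an integer, fit for
    induction. *)
Definition supp_face P p : set 'rV[R]_d :=
  P `&` [set x | dot (lat R p.1) x = p.2%:~R].

(** Naming [lin] of the face, rather than its dimension alone, makes facets with opposite normals
    parallel at once. *)
Definition facet_normal P p :=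
  [/\ p.1 != 0, forall x, P x -> dot (lat R p.1) x <= p.2%:~R,
    supp_face P p !=set0 & is_lin (supp_face P p) (hyperplane (lat R p.1))].

Lemma facet_normal_face P p : facet_normal P p -> face P (supp_face P p).
Proof. by move=> [_ ple _ _]; exists (lat R p.1), p.2%:~R. Qed.

Lemma facet_normal_facet P p : facet_normal P p -> facet P (supp_face P p).
Proof.
move=> pP; split; first exact: facet_normal_face.
have [p0 _ ne lin] := pP; split=> //; exists (hyperplane (lat R p.1)); split=> //.
by rewrite dim_hyperplane // lat_eq0.
Qed.

(** At a vertex maximizing [z], the negated dual basis of the edge directions [u i] consists of
    outer facet normals. The coefficient of [z] on [- n i] is minus the value of [z] on [u i],
    nonnegative because [z] cannot increase along an edge. *)
Lemma smooth_normal_decomposition V z (P := conv (map (@lat R d) V)) :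
  smooth P ->
  exists M x, [/\ {in M, forall p, facet_normal P p}, \sum_(p <- M) p.1 = z, P x,
    dot (lat R z) x = (\sum_(p <- M) p.2)%:~R &
    forall y, P y -> dot (lat R z) y <= (\sum_(p <- M) p.2)%:~R].
Proof.
move=> smP; have S0 := conv_neq_nil smP.1.1.1.
have [_ [/mapP[v vV ->] vtx zmax]] := conv_max_vertex (lat R z) S0.
have Pv : P (lat R v) by apply: conv_mem; rewrite map_f.
have [u [Zu ut umin]] := smooth_vertex_basis smP vtx.
have [n [nu nz nx]] := Zbasis_dual Zu.
pose k i := (z *m (u i)^T) 0 0; pose N i := (- n i, ((- n i) *m v^T) 0 0).
have dot_nu i j : dot (lat R (n i)) (lat R (u j)) = (i == j)%:R.
  by rewrite dot_lat nu; case: eqP.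
have kle0 i : k i <= 0.
  have [t t0 /zmax] := ut i.
  by rewrite dotDr dotZr gerDl pmulr_rle0 // dot_lat lerz0.
have Nmax i y : P y -> dot (lat R (N i).1) y <= (N i).2%:~R.
  rewrite /N /= -dot_lat latN !dotNl lerN2; apply: umin => j.
  by rewrite dot_nu; case: eqP.
have NP i : facet_normal P (N i).
  have Nv : supp_face P (N i) (lat R v) by split=> //=; rewrite dot_lat.
  have n0 : n i != 0.
    by apply/eqP => n0; have := nu i i; rewrite n0 mul0mx mxE eqxx.
  split; [by rewrite oppr_eq0 | exact: Nmax | by exists (lat R v) |].
  split=> [x y [_ /= xN] [_ /= yN]|W WP].
    by rewrite mem_hyperplane dotBr xN yN subrr.
  (* A vector orthogonal to [n i] is a combination of the [u j] with [j != i], and each of these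
     points from [v] to another point of the facet. *)
  apply/subvP => x; rewrite mem_hyperplane latN dotNl oppr_eq0 => /eqP nix.
  rewrite [x]nx; apply: memv_suml => j _.
  have [->|ji] := eqVneq j i; first by rewrite nix scale0r mem0v.
  apply: memvZ; have [t t0 Pt] := ut j.
  have Nt : supp_face P (N i) (lat R v + t *: lat R (u j)).
    split=> //=; rewrite dotDr dotZr -dot_lat latN !dotNl dot_nu.
    by rewrite eq_sym (negPf ji) oppr0 mulr0 addr0.
  have := WP _ _ Nt Nv; rewrite addrAC subrr add0r => /(memvZ t^-1).
  by rewrite scalerA mulVf ?scale1r // gt_eqF.
pose M := flatten [seq nseq `|k i| (N i) | i <- enum 'I_d].
have MN p : p \in M -> exists i, p = N i.
  by move=> /flatten_mapP[i _]; rewrite mem_nseq => /andP[_ /eqP ->]; exists i.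
have M1 : \sum_(p <- M) p.1 = z.
  rewrite big_flatten big_map big_enum /= [RHS]nz; apply: eq_bigr => i _.
  rewrite big_nseq iter_addr_0 -scaler_nat natz abszE ler0_norm ?kle0 //.
  by rewrite scaleNr scalerN opprK.
have M2 : dot (lat R z) (lat R v) = (\sum_(p <- M) p.2)%:~R.
  rewrite dot_lat -M1 mulmx_suml summxE; congr (_%:~R).
  by apply: eq_big_seq => p /MN[i ->].
exists M, (lat R v); split=> // [p /MN[i ->] //|y Py].
by rewrite -M2; exact: zmax.
Qed.

End LatticeCone.

(** * Combinatorial cubes *)

Section Cube.
Variables (R : realType) (d : nat).
Implicit Types (x y a : 'rV[R]_d) (P F G : set 'rV[R]_d).
Implicit Types (f : {ffun 'I_d -> bool}).

Let Q := @unit_cube R d.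

(** The order-theoretic form of a facet, which an isomorphism of face posets can transport. *)
Definition coatom P F :=
  [/\ face P F, F <> P & forall G, face P G -> F `<=` G -> G = F \/ G = P].

Definition cube_vertex f : 'rV[R]_d := \row_i (f i)%:R.

Definition cube_facet (c : 'I_d * bool) : set 'rV[R]_d :=
  Q `&` [set x | x 0 c.1 = c.2%:R].

Lemma face_refl P : face P P.
Proof.
exists 0, 0; split=> [x _|]; first by rewrite dot0l.
by rewrite eqEsubset; split=> [x Px|x []//]; split=> //=; rewrite dot0l.
Qed.

Lemma face_set0 P : face P set0.
Proof.
exists 0, 1; split=> [x _|]; first by rewrite dot0l.
rewrite eqEsubset; split=> // x [_ /=]; rewrite dot0l => /eqP.
by rewrite eq_sym oner_eq0.
Qed.

Lemma face_setI P F G : face P F -> face P G -> face P (F `&` G).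
Proof.
move=> [a [b [ab ->]]] [a' [b' [ab' ->]]]; exists (a + a'), (b + b').
split=> [x Px|]; first by rewrite dotDl lerD ?ab ?ab'.
rewrite eqEsubset; split=> x; first by move=> [[Px <-] [_ <-]]; rewrite /= dotDl.
move=> [Px /=]; rewrite dotDl => xE; have := ab _ Px; have := ab' _ Px.
by split; split=> //=; lra.
Qed.

Lemma face_bigsetI (T : eqType) (L : seq T) P (F : T -> set 'rV[R]_d) :
  {in L, forall p, face P (F p)} ->
  face P [set x | P x /\ {in L, forall p, F p x}].
Proof.
elim: L => [_|p L IH FL].
  have -> : [set x | P x /\ {in [::], forall p, F p x}] = P.
    by rewrite eqEsubset; split=> [x []|x Px].
  exact: face_refl.
have pF : face P (F p) by apply: FL; rewrite mem_head.
have LF : {in L, forall q, face P (F q)}.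
  by move=> q qL; apply: FL; rewrite inE qL orbT.
have := face_setI pF (IH LF); congr face; rewrite eqEsubset; split=> x.
  by move=> [Fpx [Px FLx]]; split=> // q; rewrite inE => /predU1P[->//|/FLx].
move=> [Px FLx]; split; first by apply: FLx; rewrite mem_head.
by split=> // q qL; apply: FLx; rewrite inE qL orbT.
Qed.

Lemma dot_delta i x : dot (delta_mx 0 i) x = x 0 i.
Proof.
rewrite /dot (bigD1 i) //= mxE !eqxx mul1r big1 ?addr0 // => j ji.
by rewrite mxE (negPf ji) andbF mul0r.
Qed.

Lemma cube_vertexP x :
  x \in [seq cube_vertex f | f <- enum {ffun 'I_d -> bool}] ->
  exists f, x = cube_vertex f.
Proof. by move=> /mapP[f _ ->]; exists f. Qed.

Lemma cube_vertex_cube f : Q (cube_vertex f).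
Proof. by apply/conv_mem/mapP; exists f; rewrite ?mem_enum. Qed.

Lemma cube_facet_face c : face Q (cube_facet c).
Proof.
case: c => i [].
  exists (delta_mx 0 i), 1; split=> [x|].
    by apply: conv_le => _ /cube_vertexP[f ->]; rewrite dot_delta mxE; case: (f i).
  by congr (_ `&` _); rewrite eqEsubset; split=> x /=; rewrite dot_delta.
exists (- delta_mx 0 i), 0; split=> [x|].
  apply: conv_le => _ /cube_vertexP[f ->].
  by rewrite dotNl dot_delta mxE oppr_le0; case: (f i).
congr (_ `&` _); rewrite eqEsubset; split=> x /=; rewrite dotNl dot_delta.
  by move=> ->; rewrite oppr0.
by move=> /eqP; rewrite oppr_eq0 => /eqP.
Qed.

Lemma cube_facet_proper c : cube_facet c <> Q.
Proof.
move=> cQ; have : cube_facet c (cube_vertex [ffun=> ~~ c.2]).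
  by rewrite cQ; exact: cube_vertex_cube.
by move=> [_ /=]; rewrite mxE ffunE => /eqP; rewrite eqr_nat; case: c.2.
Qed.

(** If [a 0 i] is nonzero, switching coordinate [i] of a cube vertex changes [dot a], so all
    vertices on the face share the better value [e] of that coordinate. *)
Lemma cube_proper_face G : (0 < d)%N -> face Q G -> G <> Q ->
  exists c, G `<=` cube_facet c.
Proof.
move=> d0 [a [b [ab ->]]] GQ; have [a0|/rV0Pn[i ai]] := eqVneq a 0.
  (* With [a = 0] only the empty face is proper, and it lies in any facet. *)
  exists (Ordinal d0, true) => x [Qx /=]; rewrite a0 dot0l => b0; case: GQ.
  rewrite a0 -b0 eqEsubset; split=> [y []//|y Qy]; split=> //=.
  by rewrite dot0l.
pose e := 0 < a 0 i; exists (i, e) => x [Qx ax]; split=> //=.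
have : x - cube_vertex [ffun=> e] \in hyperplane (delta_mx 0 i).
  apply: conv_face_sub Qx ax => [s sS|_ /cube_vertexP[f ->] af].
    exact/ab/conv_mem.
  rewrite mem_hyperplane dotBr !dot_delta !mxE ffunE.
  have [->|fi] := eqVneq (f i) e; first by rewrite subrr.
  have := ab _ (cube_vertex_cube [ffun j => if j == i then e else f j]).
  rewrite -af -subr_ge0 -dotBr /dot (bigD1 i) //= !mxE ffunE eqxx big1.
    move: fi; rewrite /e addr0; have [a_gt|a_lt|a_eq] := ltgtP 0 (a 0 i).
    - by case: (f i) => //= _; rewrite sub0r mulrN1 oppr_ge0 leNgt a_gt.
    - by case: (f i) => //= _; rewrite subr0 mulr1 leNgt a_lt.
    - by rewrite -a_eq eqxx in ai.
  by move=> j ji; rewrite !mxE ffunE (negPf ji) subrr mulr0.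
by rewrite mem_hyperplane dotBr !dot_delta mxE ffunE subr_eq0 => /eqP.
Qed.

(* The cube is dual to a flag complex: facets that meet pairwise have a common
   point, because two facets of the cube only fail to meet when opposite. *)
Lemma comb_cube_flag (T : eqType) (L : seq T) P (F : T -> set 'rV[R]_d) :
  (0 < d)%N -> comb_cube P -> {in L, forall p, coatom P (F p)} ->
  {in L &, forall p q, F p `&` F q !=set0} ->
  exists x, {in L, forall p, F p x}.
Proof.
move=> d0 [f [fP [fsurj fsub]]] FL FLI.
have f0 : f set0 = set0.
  have [F0 [faceF0 fF0]] := fsurj _ (face_set0 Q).
  by rewrite -classical_sets.subset0 -[X in _ `<=` X]fF0;
    apply: (fsub _ _ (face_set0 P) faceF0).1.
have fN0 H : face P H -> H !=set0 -> f H !=set0.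
  move=> faceH [x Hx]; apply/set0P/eqP => fH0.
  suff : H `<=` set0 by move=> /(_ _ Hx).
  by apply/(fsub _ _ faceH (face_set0 P)); rewrite fH0.
have fPQ : f P = Q.
  have [F1 [faceF1 fF1]] := fsurj _ (face_refl Q).
  rewrite eqEsubset; split; first exact: face_sub (fP _ (face_refl P)).
  by rewrite -{1}fF1; apply/(fsub _ _ faceF1 (face_refl P)); exact: face_sub.
(* The proper face [f (F p)] lies in some [cube_facet c]; pulling that facet back and using that
   [F p] is a coatom gives equality. Outside [L] the value is a dummy. *)
have /choice[c cE] p : exists c, p \in L -> f (F p) = cube_facet c.
  have [pL|pL] := boolP (p \in L); last by exists (Ordinal d0, true).
  have [faceF FP Fmax] := FL _ pL.
  have [|c Fc] := cube_proper_face d0 (fP _ faceF).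
    rewrite -fPQ => fFP; apply: FP; rewrite eqEsubset.
    by split; apply/fsub => //; rewrite ?fFP //; exact: face_refl.
  exists c => _; have [G [faceG fG]] := fsurj _ (cube_facet_face c).
  have [|GF|GP] := Fmax _ faceG; first by apply/fsub; rewrite ?fG.
    by rewrite -fG GF.
  by have := @cube_facet_proper c; rewrite -fG GP.
(* Opposite facets of the cube are disjoint, while the image of the nonempty face [F p]&[F q] lies
   in both facets. *)
have cI p q : p \in L -> q \in L -> (c p).1 = (c q).1 -> (c p).2 = (c q).2.
  move=> pL qL cpq; have [faceFp _ _] := FL _ pL; have [faceFq _ _] := FL _ qL.
  have faceI := face_setI faceFp faceFq.
  have [x fx] := fN0 _ faceI (FLI _ _ pL qL).
  have : cube_facet (c p) x.
    by rewrite -cE //; apply: (fsub _ _ faceI faceFp).1 fx; exact: subIsetl.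
  have : cube_facet (c q) x.
    by rewrite -cE //; apply: (fsub _ _ faceI faceFq).1 fx; exact: subIsetr.
  move=> [_ /= xq] [_ /= xp]; move: xp; rewrite cpq xq => /eqP.
  by rewrite eqr_nat; case: (c p).2; case: (c q).2.
(* By [cI] the facets prescribe at most one value per coordinate; the others are set to 0. So [v]
   lies on every [cube_facet (c p)] with [p] in [L]. *)
pose v := cube_vertex [ffun i => has (fun p => c p == (i, true)) L].
have [H [faceH fH]] := fsurj _
  (@face_bigsetI _ L Q (fun p => cube_facet (c p)) (fun p _ => cube_facet_face (c p))).
have [x Hx] : H !=set0.
  apply/set0P/eqP => H0; move: fH; rewrite H0 f0 => /esym/seteqP[/(_ v) + _].
  apply; split; first exact: cube_vertex_cube.
  move=> p pL; split; first exact: cube_vertex_cube.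
  rewrite /= mxE ffunE; congr (nat_of_bool _)%:R.
  case cp : (c p) => [i [|]] /=; first by apply/hasP; exists p; rewrite ?cp.
  apply/negP => /hasP[q qL /eqP cq].
  by have := cI _ _ pL qL; rewrite cp cq => /(_ erefl).
exists x => p pL; have [faceFp _ _] := FL _ pL.
by apply: (fsub _ _ faceH faceFp).2 Hx; rewrite fH cE // => y [_]; exact.
Qed.

(** A face containing the facet comes from a functional [a] constant on it. If [a] is nonzero, equal
    dimensions identify its hyperplane with that of [p.1], so the face is no larger; if [a = 0] it
    is all of [P]. *)
Lemma facet_normal_coatom P p : (0 < d)%N -> has_dim P d ->
  facet_normal P p -> coatom P (supp_face P p).
Proof.
move=> d0 [_ [U [PU dimU]]] pP; have [p0 _ [x0 Fx0] Flin] := pP.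
have lp0 : lat R p.1 != 0 by rewrite lat_eq0.
split; first exact: facet_normal_face.
  move=> FP; rewrite FP in Flin; have := dim_hyperplane lp0.
  by rewrite (is_lin_uniq Flin PU) dimU; case: (d) d0 => // k _ /esym; exact: n_Sn.
move=> G [a [b [ab ->]]] FG; have [_ /= ax0] := FG _ Fx0.
have [a0|a0] := eqVneq a 0; [right|left].
  rewrite eqEsubset; split=> [y []//|y Py]; split=> //=.
  by rewrite -ax0 a0 !dot0l.
have hpa : hyperplane (lat R p.1) = hyperplane a.
  apply/eqP; rewrite eqEdim !dim_hyperplane // leqnn andbT; apply: Flin.2.
  move=> x y /FG[_ /= ax] /FG[_ /= ay].
  by rewrite mem_hyperplane dotBr ax ay subrr.
rewrite eqEsubset; split=> // y [Py /= ay]; split=> //=.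
have : y - x0 \in hyperplane (lat R p.1).
  by rewrite hpa mem_hyperplane dotBr ay ax0 subrr.
by rewrite mem_hyperplane dotBr subr_eq0 => /eqP ->; have [] := Fx0.
Qed.

(* Batyrev's argument: replacing a pair of normals with disjoint facets in a
   relation by the decomposition of their sum lowers the degree [\sum p.2], so
   a relation of least degree is a pair of opposite normals. *)
Lemma opposite_normals (V : seq 'rV[int]_d) (P := conv (map (@lat R d) V)) L :
  (0 < d)%N -> has_dim P d -> smooth P -> comb_cube P ->
  L != [::] -> {in L, forall p, facet_normal P p} -> \sum_(p <- L) p.1 = 0 ->
  exists p q, [/\ facet_normal P p, facet_normal P q,
    supp_face P p `&` supp_face P q = set0 & p.1 + q.1 = 0].
Proof.
move=> d0 dimP smP cubeP.
have [x0 Px0] := dimP.1.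
suff: forall (n : nat) L, L != [::] -> {in L, forall p, facet_normal P p} ->
    \sum_(p <- L) p.1 = 0 -> \sum_(p <- L) p.2 < n%:Z ->
    exists p q, [/\ facet_normal P p, facet_normal P q,
      supp_face P p `&` supp_face P q = set0 & p.1 + q.1 = 0].
  move=> main L0 LP L1; apply: (main `|\sum_(p <- L) p.2|.+1 L) => //.
  by rewrite intS addrC ltzD1 abszE ler_norm.
(* Induction on a strict upper bound for the degree. The degree is never negative: at [x0] the
   functionals sum to 0 and each is at most its height. *)
elim=> [|n IH] {}L L0 LP L1 Ln.
  have : (\sum_(p <- L) p.2)%:~R < 0 :> R by rewrite ltrz0.
  rewrite ltNge => /negP[].
  rewrite -(dot0l x0) -(lat0 R) -L1 lat_sum dot_suml rmorph_sum.
  by rewrite big_seq [leRHS]big_seq; apply: ler_sum => p /LP[_ ple _ _]; exact: ple.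
(* If all pairs met, the flag property would give a common point, so the heights would sum to 0.
   Each functional, bounded by its height, would then equal it on all of [P], but a coatom is
   proper. *)
have [p [q [pL qL pq0]]] : exists p q, [/\ p \in L, q \in L &
    supp_face P p `&` supp_face P q = set0].
  apply: contrapT => meet.
  have Lco : {in L, forall p, coatom P (supp_face P p)}.
    by move=> p /LP; exact: facet_normal_coatom.
  have [|x xL] := comb_cube_flag d0 cubeP Lco.
    by move=> p q pL qL; apply/set0P/eqP => pq0; apply: meet; exists p, q.
  case: L L0 {Ln meet IH} LP L1 Lco xL => // p L _ LP L1 Lco xL.
  have pL : p \in p :: L by rewrite mem_head.
  have [_ pP _] := Lco p pL; apply: pP; rewrite eqEsubset; split=> [y []//|y Py].
  have deg0 : \sum_(q <- p :: L) q.2%:~R = 0 :> R.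
    rewrite -[RHS](dot0l x) -(lat0 R) -L1 lat_sum dot_suml.
    by apply: eq_big_seq => q /xL[_ /= ->].
  have : \sum_(q <- p :: L) (q.2%:~R - dot (lat R q.1) y) = 0.
    by rewrite sumrB -dot_suml -lat_sum L1 lat0 dot0l deg0 subrr.
  have LPy q : q \in p :: L -> 0 <= q.2%:~R - dot (lat R q.1) y.
    by move=> /LP[_ qle _ _]; rewrite subr_ge0 qle.
  rewrite big_cons => /eqP; rewrite paddr_eq0 ?LPy //; last first.
    by rewrite big_seq sumr_ge0 // => q qL; rewrite LPy // inE qL orbT.
  by rewrite subr_eq0 => /andP[/eqP pE _]; split=> //=; rewrite pE.
have qp : q != p.
  apply/eqP => qp; have [_ _ [x px] _] := LP _ pL.
  by move: pq0; rewrite qp setIid => p0; rewrite p0 in px.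
have Lperm : perm_eq L (p :: q :: rem q (rem p L)).
  have := perm_to_rem pL => /perm_trans; apply; rewrite perm_cons perm_to_rem //.
  by have := perm_mem (perm_to_rem pL) q; rewrite qL inE (negPf qp) => /esym.
set L' := rem q (rem p L) in Lperm.
have [M [x [MP M1 Px xM _]]] := smooth_normal_decomposition (p.1 + q.1) smP.
(* The degree of [M] is the value of [p.1 + q.1] at [x]; as the two facets are disjoint, [x] misses
   at least one of them and that inequality is strict. *)
have Mlt : \sum_(r <- M) r.2 < p.2 + q.2.
  rewrite -(ltr_int R) -xM latD dotDl rmorphD /=.
  have [_ ple _ _] := LP _ pL; have [_ qle _ _] := LP _ qL.
  have := ple _ Px; have := qle _ Px; rewrite !le_eqVlt.
  move=> /predU1P[qx|qx] /predU1P[px|px].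
  - have : (supp_face P p `&` supp_face P q) x by [].
    by rewrite pq0.
  - by rewrite qx ltrD2r.
  - by rewrite px ltrD2l.
  - exact: ltrD.
have [|ML0] := eqVneq (M ++ L') [::].
  move=> /eqP; rewrite -size_eq0 size_cat addn_eq0 !size_eq0 => /andP[/eqP M0 _].
  exists p, q; split=> //; [exact: LP | exact: LP |].
  by rewrite -M1 M0 big_nil.
apply: (IH (M ++ L')) => //.
- move=> r; rewrite mem_cat => /orP[/MP //|rL']; apply: LP.
  by rewrite (perm_mem Lperm) !inE rL' !orbT.
- by rewrite big_cat /= M1 -addrA -[RHS]L1 (perm_big _ Lperm) /= !big_cons.
move: Ln; rewrite (perm_big _ Lperm) /= !big_cons big_cat /= addrA => Ln.
have -> : n%:Z = n.+1%:Z - 1 by rewrite intS addrAC subrr add0r.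
by rewrite ltrBrDr; apply: le_lt_trans Ln; rewrite lezD1 ltrD2r.
Qed.

End Cube.

Theorem theorem3p7 (R : realType) (d : nat) (C : set 'rV[R]_d) :
  (2 <= d)%N ->
  lattice_polytope C -> has_dim C d -> smooth C -> comb_cube C ->
  exists F G : set 'rV[R]_d,
    facet C F /\ facet C G /\ F <> G /\ parallel F G.
Proof.
move=> d2 [V ->] dimC smC cubeC; have d0 : (0 < d)%N by apply: ltn_trans d2.
set P := conv _ in dimC smC cubeC *.
(* Joining the decompositions of [z] and [- z] gives a starting relation, nonempty because [z] is
   nonzero. *)
pose z : 'rV[int]_d := delta_mx 0 (Ordinal d0).
have [M [_ [MP M1 _ _ _]]] := smooth_normal_decomposition z smC.
have [N [_ [NP N1 _ _ _]]] := smooth_normal_decomposition (- z) smC.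
have [||| p [q [pP qP pq0 pq]]] := @opposite_normals R d V (M ++ N) d0 dimC smC cubeC.
- apply/eqP => /(congr1 size)/eqP.
  rewrite size_cat addn_eq0 size_eq0 => /andP[/eqP M0 _].
  move: M1; rewrite M0 big_nil => /rowP/(_ (Ordinal d0)).
  by rewrite !mxE !eqxx.
- by move=> r; rewrite mem_cat => /orP[/MP|/NP].
- by rewrite big_cat /= M1 N1 subrr.
exists (supp_face P p), (supp_face P q).
split; first exact: facet_normal_facet.
split; first exact: facet_normal_facet.
have [_ _ [x px] pU] := pP; have [_ _ _ qU] := qP; split.
  by move=> pq_eq; move: pq0; rewrite -pq_eq setIid => p0; rewrite p0 in px.
exists (hyperplane (lat R p.1)); split=> //.
suff <- : hyperplane (lat R q.1) = hyperplane (lat R p.1) by [].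
apply/vspaceP => y; have /eqP := pq; rewrite addrC addr_eq0 => /eqP ->.
by rewrite !mem_hyperplane latN dotNl oppr_eq0.
Qed.
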